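(* Let $F,S\in\mathcal{C}(I,\mathcal{K}_c(\mathbb{R}))$ satisfy $S(u_1)-F(u_1)=S(u_N)-F(u_N)$, let $\alpha\in(-1,1)$, and let $F^\alpha$ be the corresponding $\alpha$-fractal function. For each $j\in J$ define $W_j:I\times\mathcal{K}_c(\mathbb{R})\to I\times\mathcal{K}_c(\mathbb{R})$ by $$W_j(u,A)=\left(L_j(u),\ \alpha A+F(L_j(u))-\alpha S(u)\right).$$ Then the graph $\mathcal{G}(F^{\alpha})=\{(u,F^\alpha(u)):u\in I\}\subset I\times\mathcal{K}_c(\mathbb{R})$ is an attractor of the iterated function system $\{(I\times\mathcal{K}_c(\mathbb{R}),\mathfrak{d});W_1,\ldots,W_{N-1}\}$.
   Context: $\mathcal{K}(\mathbb{R})$ is the collection of nonempty compact subsets of $\mathbb{R}$, with the Hausdorff metric $H_d$; $\mathcal{K}_c(\mathbb{R})$ is the subcollection of convex ones. For sets $A,B$ and $\lambda\in\mathbb{R}$: $A+B=\{a+b\}$ (Minkowski sum), $\lambda A=\{\lambda a\}$, $A-B=\{a-b:a\in A,b\in B\}$. $\mathcal{C}(I,\mathcal{K}_c(\mathbb{R}))$ is the set of continuous maps. Setting: $I=[u_1,u_N]$ with partition $\Delta: u_1<\cdots<u_N$, $J=\{1,\ldots,N-1\}$, $I_j=[u_j,u_{j+1}]$, and $L_j:I\to I_j$ is the affine contraction $L_j(u)=a_ju+b_j$ with $L_j(u_1)=u_j$, $L_j(u_N)=u_{j+1}$, so $a_j=\frac{u_{j+1}-u_j}{u_N-u_1}\in(0,1)$.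 $F^\alpha$ is the unique continuous map with $F^{\alpha}(u)=F(u)+\alpha[F^{\alpha}(L_j^{-1}(u))-S(L_j^{-1}(u))]$ for every $u\in I_j$, $j\in J$; it takes values in $\mathcal{K}_c(\mathbb{R})$. The metric on $I\times\mathcal{K}_c(\mathbb{R})$ is $\mathfrak{d}((u,A),(w,B))=|u-w|+H_d(A+F^\alpha(w),B+F^\alpha(u))$. An iterated function system is a complete metric space together with finitely many contraction self-maps; its attractor is the nonempty compact set $K$ with $K=\bigcup_jW_j(K)$. *)

(* Defs.v *)
From HB Require Import structures.
From mathcomp Require Import all_boot all_order all_algebra.
From mathcomp Require Import all_classical all_reals all_analysis.
From mathcomp Require Import interval_inference lra ring.

Set Implicit Arguments.
Unset Strict Implicit.
Unset Printing Implicit Defensive.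

Import Order.TTheory GRing.Theory Num.Theory.
Import numFieldNormedType.Exports.

Local Open Scope classical_set_scope.
Local Open Scope ring_scope.

Section SetOperations.
Context {R : realType}.
Implicit Types A B : set R.

Definition set_add A B : set R := [set a + b | a in A & b in B].
Definition set_sub A B : set R := [set a - b | a in A & b in B].
Definition set_scale (l : R) A : set R := [set l * a | a in A].

(* The two suprema and infima are genuine (not the default value 0) when [A]
   and [B] are nonempty and bounded, in particular on nonempty compact sets. *)
Definition hausdorff_dist A B : R :=
  Num.max (sup [set inf [set `|a - b| | b in B] | a in A])
          (sup [set inf [set `|a - b| | a in A] | b in B]).

End SetOperations.

Record Kc (R : realType) := MkKc {
  Kc_set :> set R ;
  Kc_neq0 : Kc_set !=set0 ;
  Kc_compact : compact Kc_set ;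
  Kc_convex : convex_set (Kc_set : set R^o) }.

Section KcTheory.
Context {R : realType}.
Implicit Types A B C : Kc R.

Lemma Kc_eq A B : Kc_set A = Kc_set B -> A = B.
Proof.
case: A B => [A a1 a2 a3] [B b1 b2 b3] /= AB; subst B.
by congr MkKc; exact: Prop_irrelevance.
Qed.

Lemma convex_setP (A : set R) : convex_set (A : set R^o) <->
  forall x y t, A x -> A y -> 0 <= t <= 1 -> A (t * x + (1 - t) * y).
Proof.
split=> [cA x y t Ax Ay /andP[t0 t1]|cA x y t].
  by have := cA x y (Itv01 t0 t1); rewrite !inE => /(_ Ax Ay).
rewrite !inE => Ax Ay.
by have := cA x y t%:num Ax Ay; apply; apply/andP; split.
Qed.

Fact set_add_neq0 A B : set_add A B !=set0.
Proof.
have [a Aa] := Kc_neq0 A; have [b Bb] := Kc_neq0 B.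
by exists (a + b); exists a => //; exists b.
Qed.

Fact set_add_compact A B : compact (set_add A B).
Proof.
have -> : set_add A B = (fun p : R * R => p.1 + p.2) @` (A `*` B).
  apply/seteqP; split => [_ [a Aa [b Bb <-]]|_ [[a b] [/= Aa Bb] <-]].
    by exists (a, b).
  by exists a => //; exists b.
apply: continuous_compact.
  by apply: continuous_subspaceT => p; apply: cvgD; [exact: cvg_fst|exact: cvg_snd].
by apply: compact_setX; exact: Kc_compact.
Qed.

Fact set_add_convex A B : convex_set (set_add A B : set R^o).
Proof.
apply/convex_setP => _ _ t [a Aa [b Bb <-]] [c Ac [d Bd <-]] t01.
exists (t * a + (1 - t) * c).
  by have /convex_setP := @Kc_convex _ A; exact.
exists (t * b + (1 - t) * d).
  by have /convex_setP := @Kc_convex _ B; exact.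
by ring.
Qed.

Definition Kc_add A B : Kc R :=
  MkKc (set_add_neq0 A B) (@set_add_compact A B) (@set_add_convex A B).

Fact set_scale_neq0 l A : set_scale l A !=set0.
Proof. by have [a Aa] := Kc_neq0 A; exists (l * a); exists a. Qed.

Fact set_scale_compact l A : compact (set_scale l A).
Proof.
apply: continuous_compact; last exact: Kc_compact.
by apply: continuous_subspaceT => p; exact: mulrl_continuous.
Qed.

Fact set_scale_convex l A : convex_set (set_scale l A : set R^o).
Proof.
apply/convex_setP => _ _ t [a Aa <-] [c Ac <-] t01.
exists (t * a + (1 - t) * c).
  by have /convex_setP := @Kc_convex _ A; exact.
by ring.
Qed.

Definition Kc_scale l A : Kc R :=
  MkKc (set_scale_neq0 l A) (@set_scale_compact l A) (@set_scale_convex l A).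

Lemma set_subE (A B : set R) : set_sub A B = set_add A (set_scale (-1) B).
Proof.
apply/seteqP; split => [_ [a Aa [b Bb <-]]|_ [a Aa [_ [b Bb <-] <-]]].
  by exists a => //; exists (- 1 * b); [exists b|rewrite mulN1r].
by exists a => //; exists b => //; rewrite mulN1r.
Qed.

Fact set_sub_neq0 A B : set_sub A B !=set0.
Proof. by rewrite set_subE; exact: (Kc_neq0 (Kc_add A (Kc_scale (-1) B))). Qed.

Fact set_sub_compact A B : compact (set_sub A B).
Proof. by rewrite set_subE; exact: (@Kc_compact _ (Kc_add A (Kc_scale (-1) B))). Qed.

Fact set_sub_convex A B : convex_set (set_sub A B : set R^o).
Proof. by rewrite set_subE; exact: (@Kc_convex _ (Kc_add A (Kc_scale (-1) B))). Qed.

Definition Kc_sub A B : Kc R :=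
  MkKc (set_sub_neq0 A B) (@set_sub_compact A B) (@set_sub_convex A B).

Lemma Kc_has_ubound A : has_ubound A.
Proof.
have /compact_bounded[M [_ Mb]] := @Kc_compact _ A.
exists (M + 1) => x Ax; apply: le_trans (ler_norm x) _.
by apply: Mb Ax; rewrite ltrDl.
Qed.

Lemma Kc_has_lbound A : has_lbound A.
Proof.
have /compact_bounded[M [_ Mb]] := @Kc_compact _ A.
exists (- (M + 1)) => x Ax; rewrite lerNl.
apply: le_trans (ler_norm (- x)) _; rewrite normrN.
by apply: Mb Ax; rewrite ltrDl.
Qed.

Lemma Kc_closed A : closed A.
Proof. by apply: compact_closed; [exact: Rhausdorff|exact: Kc_compact]. Qed.

Lemma Kc_sup_mem A : Kc_set A (sup A).
Proof.
have /closure_id clA := @Kc_closed A.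
by have := closure_sup (Kc_neq0 A) (Kc_has_ubound A); rewrite -clA.
Qed.

Lemma Kc_inf_mem A : Kc_set A (inf A).
Proof.
suff [a Aa /eqP] : set_scale (-1) A (- inf A).
  by rewrite mulN1r eqr_opp => /eqP <-.
rewrite /inf opprK.
have -> : -%R @` A = Kc_scale (-1) A.
  by apply/seteqP; split => _ [x Ax <-]; exists x; rewrite ?mulN1r.
exact: (Kc_sup_mem (Kc_scale (-1) A)).
Qed.

Lemma Kc_le_sup A x : Kc_set A x -> x <= sup A.
Proof. by apply: ub_le_sup; exact: Kc_has_ubound. Qed.

Lemma Kc_ge_inf A x : Kc_set A x -> inf A <= x.
Proof. by apply: ge_inf; exact: Kc_has_lbound. Qed.

Lemma Kc_inf_le_sup A : inf A <= sup A.
Proof. by apply: Kc_le_sup; exact: Kc_inf_mem. Qed.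

Lemma KcE A : Kc_set A = `[inf A, sup A]%classic.
Proof.
apply/seteqP; split => x /=; rewrite in_itv/=.
  by move=> Ax; rewrite Kc_ge_inf// Kc_le_sup.
move=> /andP[ix xs].
have [e|ne] := eqVneq (sup A) (inf A).
  have -> : x = inf A by apply/le_anti; rewrite ix andbT -e.
  exact: Kc_inf_mem.
have d0 : 0 < sup A - inf A by rewrite subr_gt0 lt_neqAle eq_sym ne Kc_inf_le_sup.
have /convex_setP/(_ (inf A) (sup A) ((sup A - x) / (sup A - inf A))) :=
  @Kc_convex _ A.
move/(_ (Kc_inf_mem A) (Kc_sup_mem A)).
have -> : (sup A - x) / (sup A - inf A) * inf A +
  (1 - (sup A - x) / (sup A - inf A)) * sup A = x by field; rewrite gt_eqF.
apply; rewrite ler_pdivrMr// ler_pdivlMr// mul0r mul1r subr_ge0 xs/=.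
by rewrite lerD2l lerN2.
Qed.

Lemma Kc_memE A x : Kc_set A x <-> inf A <= x <= sup A.
Proof. by rewrite {1}KcE /= in_itv. Qed.

Lemma Kc_eq_inf_sup A B : inf A = inf B -> sup A = sup B -> A = B.
Proof. by move=> ei es; apply: Kc_eq; rewrite KcE (KcE B) ei es. Qed.

Lemma sup_Kc_add A B : sup (Kc_add A B) = sup A + sup B.
Proof.
apply/le_anti/andP; split.
  apply: ge_sup; first exact: Kc_neq0.
  by move=> _ [a Aa [b Bb <-]]; rewrite lerD// Kc_le_sup.
apply: Kc_le_sup; exists (sup A); first exact: Kc_sup_mem.
by exists (sup B) => //; exact: Kc_sup_mem.
Qed.

Lemma inf_Kc_add A B : inf (Kc_add A B) = inf A + inf B.
Proof.
apply/le_anti/andP; split; last first.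
  apply: lb_le_inf; first exact: Kc_neq0.
  by move=> _ [a Aa [b Bb <-]]; rewrite lerD// Kc_ge_inf.
apply: Kc_ge_inf; exists (inf A); first exact: Kc_inf_mem.
by exists (inf B) => //; exact: Kc_inf_mem.
Qed.

Lemma Kc_sup_inf_dist A B :
  sup [set inf [set `|a - b| | b in B] | a in A] =
  Num.max 0 (Num.max (inf B - inf A) (sup A - sup B)).
Proof.
have infB a : Kc_set A a -> inf [set `|a - b| | b in B] =
    Num.max 0 (Num.max (inf B - a) (a - sup B)).
  move=> Aa.
  have B0 : [set `|a - b| | b in B] !=set0.
    by have [b Bb] := Kc_neq0 B; exists `|a - b|; exists b.
  have le_b b : Kc_set B b -> Num.max 0 (Num.max (inf B - a) (a - sup B)) <= `|a - b|.
    move=> /Kc_memE/andP[b1 b2]; rewrite !ge_max normr_ge0/=.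
    by have := ler_norm (a - b); have := ler_norm (b - a); rewrite distrC; lra.
  apply/le_anti/andP; split; last first.
    by apply: lb_le_inf => // _ [b /le_b + <-].
  pose b := if a < inf B then inf B else if sup B < a then sup B else a.
  have isB := Kc_inf_le_sup B.
  have Bb : Kc_set B b.
    apply/Kc_memE; rewrite /b; case: ltP => h1; first lra.
    by case: ltP => h2; lra.
  apply: (@le_trans _ _ `|a - b|).
    apply: ge_inf; last by exists b.
    by exists 0 => _ [c _ <-].
  rewrite /b !le_max; case: ltP => h1.
    by rewrite ltr0_norm ?opprB ?lexx ?orbT// subr_lt0.
  case: ltP => h2; last by rewrite subrr normr0 lexx.
  by rewrite gtr0_norm ?lexx ?orbT// subr_gt0.
rewrite (_ : [set _ | a in _] =
  [set Num.max 0 (Num.max (inf B - a) (a - sup B)) | a in A]); last first.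
  by apply/seteqP; split => _ [a Aa <-]; exists a => //; rewrite infB.
have ubA : ubound [set Num.max 0 (Num.max (inf B - a) (a - sup B)) | a in A]
    (Num.max 0 (Num.max (inf B - inf A) (sup A - sup B))).
  move=> _ [a /Kc_memE/andP[a1 a2] <-]; rewrite ge_max le_max lexx/= ge_max.
  apply/andP; split; rewrite le_max; apply/orP; right; rewrite le_max.
    by rewrite lerD2l lerN2 a1.
  by rewrite lerD2r a2 orbT.
apply/le_anti/andP; split.
  apply: ge_sup => //; have [a Aa] := Kc_neq0 A.
  by exists (Num.max 0 (Num.max (inf B - a) (a - sup B))); exists a.
have hub : has_ubound
    [set Num.max 0 (Num.max (inf B - a) (a - sup B)) | a in A].
  by eexists; exact: ubA.
have le_s a : Kc_set A a -> Num.max 0 (Num.max (inf B - a) (a - sup B)) <=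
    sup [set Num.max 0 (Num.max (inf B - a) (a - sup B)) | a in A].
  by move=> Aa; apply: ub_le_sup => //; exists a.
have := le_s _ (Kc_inf_mem A); have := le_s _ (Kc_sup_mem A).
by rewrite !ge_max => /and3P[-> _ ->] /and3P[_ -> _].
Qed.

Lemma hausdorff_distE A B :
  hausdorff_dist A B = Num.max `|inf A - inf B| `|sup A - sup B|.
Proof.
have -> : hausdorff_dist A B =
    Num.max (sup [set inf [set `|a - b| | b in B] | a in A])
            (sup [set inf [set `|b - a| | a in A] | b in B]).
  congr (Num.max _ (sup _)); congr image; apply/funext => b; congr (inf _).
  by congr image; apply/funext => a; rewrite distrC.
rewrite !Kc_sup_inf_dist.
set a := inf A; set b := inf B; set c := sup A; set d := sup B.
apply/le_anti/andP; split; rewrite !ge_max !le_max.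
  have ab := ler_norm (a - b); have ba := ler_norm (b - a).
  have cd := ler_norm (c - d); have dc := ler_norm (d - c).
  rewrite (distrC b) in ba; rewrite (distrC d) in dc.
  by rewrite !normr_ge0 ab ba cd dc !orbT.
apply/andP; split.
  by case: (ler0P (a - b)) => _; rewrite ?opprB lexx !orbT.
by case: (ler0P (c - d)) => _; rewrite ?opprB lexx !orbT.
Qed.

Lemma hausdorff_distxx A : hausdorff_dist A A = 0.
Proof. by rewrite hausdorff_distE !subrr normr0 maxxx. Qed.

Lemma hausdorff_dist_eq0 A B : hausdorff_dist A B = 0 -> A = B.
Proof.
rewrite hausdorff_distE => /eqP; rewrite eq_le ge_max !normr_le0 !subr_eq0.
by move=> /andP[/andP[/eqP ? /eqP ?] _]; exact: Kc_eq_inf_sup.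
Qed.

Lemma hausdorff_distC (A B : set R) : hausdorff_dist A B = hausdorff_dist B A.
Proof.
rewrite /hausdorff_dist maxC; congr (Num.max (sup _) (sup _));
  congr image; apply/funext => x; congr (inf _); congr image;
  by apply/funext => y; rewrite distrC.
Qed.

Lemma hausdorff_dist_triangle B A C :
  hausdorff_dist A C <= hausdorff_dist A B + hausdorff_dist B C.
Proof.
rewrite !hausdorff_distE ge_max; apply/andP; split.
  by rewrite (le_trans (ler_distD (inf B) _ _))// lerD// le_max lexx.
by rewrite (le_trans (ler_distD (sup B) _ _))// lerD// le_max lexx orbT.
Qed.

(* The cancellation law fails for general compact sets; it is what makes the
   twisted distance on the fractal space below a metric. *)
Lemma hausdorff_dist_addr A B C :
  hausdorff_dist (Kc_add A C) (Kc_add B C) = hausdorff_dist A B.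
Proof.
have E (x y z : R) : x + z - (y + z) = x - y by ring.
by rewrite !hausdorff_distE !inf_Kc_add !sup_Kc_add !E.
Qed.

Lemma Kc_addA : associative Kc_add.
Proof.
by move=> A B C; apply: Kc_eq_inf_sup; rewrite !(inf_Kc_add, sup_Kc_add) addrA.
Qed.

Lemma Kc_addC : commutative Kc_add.
Proof.
by move=> A B; apply: Kc_eq_inf_sup; rewrite !(inf_Kc_add, sup_Kc_add) addrC.
Qed.

End KcTheory.

Arguments Kc_add : simpl never.
Arguments Kc_sub : simpl never.
Arguments Kc_scale : simpl never.

HB.instance Definition _ (R : realType) := gen_eqMixin (Kc R).
HB.instance Definition _ (R : realType) := gen_choiceMixin (Kc R).

HB.instance Definition _ (R : realType) := @isMetric.Build R (Kc R)
  (fun A B => hausdorff_dist A B) hausdorff_distxx hausdorff_dist_eq0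
  (fun A B => hausdorff_distC A B) hausdorff_dist_triangle.

Lemma Kc_mdistE (R : realType) (A B : Kc R) : mdist A B = hausdorff_dist A B.
Proof. by []. Qed.

Declare Scope Kc_scope.
Delimit Scope Kc_scope with K.
Bind Scope Kc_scope with Kc.
Notation "A + B" := (Kc_add A B) : Kc_scope.
Notation "A - B" := (Kc_sub A B) : Kc_scope.
Notation "l *: A" := (Kc_scale l A) : Kc_scope.

(* [n.+1] knots indexed from 0: with N = n + 1, the knot u_{i+1} of the
   classical 1-based notation u_1 < ... < u_N is [knot i]. *)
Record interval_partition (R : realType) (n : nat) := IntervalPartition {
  knot :> 'I_n.+1 -> R ;
  knot_lt : {homo knot : i j / (i < j)%N >-> i < j} }.

Section Fractal.
Context {R : realType} {n : nat} (u : interval_partition R n).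
Implicit Types j : 'I_n.

Definition kleft j : R := u (widen_ord (leqnSn n) j).
Definition kright j : R := u (lift ord0 j).

Definition base_itv : Type := `[u ord0, u ord_max]%classic.
HB.instance Definition _ := PseudoMetric.on base_itv.

Definition slope j : R := (kright j - kleft j) / (u ord_max - u ord0).
Definition offset j : R := kleft j - slope j * u ord0.

Lemma knot_le : {homo (u : _ -> R) : i k / (i <= k)%N >-> i <= k}.
Proof.
move=> i k; rewrite leq_eqVlt => /predU1P[/val_inj->//|/(@knot_lt _ _ u)].
exact: ltW.
Qed.

Lemma kleft_lt_kright j : kleft j < kright j.
Proof. by apply: knot_lt => /=; rewrite /bump/= add1n. Qed.

Lemma knot0_lt_max j : u ord0 < u ord_max.
Proof.
apply: le_lt_trans (_ : kleft j < _); first by apply: knot_le.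
by apply: lt_le_trans (kleft_lt_kright j) _; apply: knot_le; exact: leq_ord.
Qed.

Fact to_base_subproof (y : R) : u ord0 <= y <= u ord_max ->
  y \in `[u ord0, u ord_max]%classic.
Proof. by rewrite inE/= in_itv. Qed.

Definition to_base (y : R) (yP : u ord0 <= y <= u ord_max) : base_itv :=
  exist (fun z => z \in `[u ord0, u ord_max]%classic) y (to_base_subproof yP).

Lemma baseP (x : base_itv) : u ord0 <= val x <= u ord_max.
Proof. by have := valP x; rewrite inE/= in_itv. Qed.

Lemma slope_gt0 j : 0 < slope j.
Proof. by rewrite divr_gt0// subr_gt0 ?kleft_lt_kright// knot0_lt_max. Qed.

Lemma affine_left j : slope j * u ord0 + offset j = kleft j.
Proof. by rewrite /offset; ring. Qed.

Lemma affine_right j : slope j * u ord_max + offset j = kright j.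
Proof.
rewrite /offset /slope; field.
by rewrite gt_eqF// subr_gt0 (knot0_lt_max j).
Qed.

Fact L_subproof j (x : base_itv) :
  u ord0 <= slope j * val x + offset j <= u ord_max.
Proof.
have /andP[x0 x1] := baseP x; have s0 := slope_gt0 j.
apply/andP; split.
  apply: le_trans (_ : kleft j <= _); first by apply: knot_le.
  by rewrite -affine_left lerD2r (ler_pM2l s0).
apply: le_trans (_ : _ <= kright j) _; last by apply: knot_le; exact: leq_ord.
by rewrite -affine_right lerD2r ler_pM2l.
Qed.

Definition Lmap j (x : base_itv) : base_itv := to_base (L_subproof j x).

Fact Linv_subproof j (x : base_itv) : val x \in `[kleft j, kright j] ->
  u ord0 <= (val x - offset j) / slope j <= u ord_max.
Proof.
rewrite in_itv/= => /andP[x0 x1]; have s0 := slope_gt0 j.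
rewrite ler_pdivlMr// ler_pdivrMr// lerBrDr lerBlDr.
by rewrite ![_ * slope j]mulrC affine_left affine_right x0.
Qed.

Definition Linv j (x : base_itv) (xj : val x \in `[kleft j, kright j]) : base_itv :=
  to_base (Linv_subproof xj).

Lemma LK j (x : base_itv) (Lxj : val (Lmap j x) \in `[kleft j, kright j]) :
  Linv Lxj = x.
Proof.
by apply: val_inj => /=; rewrite addrK mulrC mulKf// gt_eqF// slope_gt0.
Qed.

Lemma LinvK j (x : base_itv) (xj : val x \in `[kleft j, kright j]) :
  Lmap j (Linv xj) = x.
Proof.
by apply: val_inj => /=; rewrite mulrC divfK ?subrK// gt_eqF// slope_gt0.
Qed.

Fact first_subproof : u ord0 <= u ord0 <= u ord_max.
Proof. by rewrite lexx knot_le. Qed.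

Fact last_subproof : u ord0 <= u ord_max <= u ord_max.
Proof. by rewrite lexx knot_le. Qed.

Definition first_knot : base_itv := to_base first_subproof.
Definition last_knot : base_itv := to_base last_subproof.

Implicit Types F S Fa : base_itv -> Kc R.

(* Uniqueness of such a map is a consequence of `|alpha| < 1. *)
Definition is_fractal_function F S (alpha : R) Fa :=
  continuous Fa /\
  forall j (x : base_itv) (xj : val x \in `[kleft j, kright j]),
    Fa x = (F x + alpha *: (Fa (Linv xj) - S (Linv xj)))%K.

(* The product [base_itv * Kc R], equipped not with the product metric but with a
   metric that depends on [Fa]. *)
Definition fractal_space Fa : Type := (base_itv * Kc R)%type.

Section FractalMetric.
Variable Fa : base_itv -> Kc R.
Implicit Types p q r : fractal_space Fa.

Definition fractal_dist p q : R :=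
  `|val p.1 - val q.1| + hausdorff_dist (p.2 + Fa q.1)%K (q.2 + Fa p.1)%K.

Fact fractal_distxx p : fractal_dist p p = 0.
Proof. by rewrite /fractal_dist subrr normr0 add0r hausdorff_distxx. Qed.

Fact fractal_dist_eq0 p q : fractal_dist p q = 0 -> p = q.
Proof.
have hd0 (C D : Kc R) : 0 <= hausdorff_dist C D by rewrite -Kc_mdistE mdist_ge0.
rewrite /fractal_dist => /eqP; rewrite paddr_eq0 ?normr_ge0 ?hd0//.
rewrite normr_eq0 subr_eq0 => /andP[/eqP/val_inj e1 /eqP].
rewrite e1 hausdorff_dist_addr => /hausdorff_dist_eq0 e2.
by case: p q e1 e2 => [? ?] [? ?] /= -> ->.
Qed.

Fact fractal_dist_sym p q : fractal_dist p q = fractal_dist q p.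
Proof. by rewrite /fractal_dist distrC hausdorff_distC. Qed.

Fact fractal_dist_triangle q p r :
  fractal_dist p r <= fractal_dist p q + fractal_dist q r.
Proof.
case: p q r => [x A] [y B] [z C].
rewrite /fractal_dist ![(_, _).1]/= ![(_, _).2]/= addrACA.
rewrite lerD ?ler_distD//.
rewrite -(hausdorff_dist_addr (A + Fa z) (C + Fa x) (Fa y)).
rewrite -(hausdorff_dist_addr (A + Fa y) (B + Fa x) (Fa z)).
rewrite -(hausdorff_dist_addr (B + Fa z) (C + Fa y) (Fa x)).
have swap (D E G : Kc R) : (D + E + G = D + G + E)%K.
  by rewrite -!Kc_addA (Kc_addC E).
rewrite (swap A) (swap B (Fa z)) (swap C).
exact: hausdorff_dist_triangle.
Qed.

HB.instance Definition _ := Choice.copy (fractal_space Fa) (base_itv * Kc R)%type.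
HB.instance Definition _ := @isMetric.Build R (fractal_space Fa)
  fractal_dist fractal_distxx fractal_dist_eq0 fractal_dist_sym
  fractal_dist_triangle.

Lemma fractal_mdistE p q : mdist p q = fractal_dist p q.
Proof. by []. Qed.

End FractalMetric.

Definition fractal_graph Fa : set (fractal_space Fa) :=
  [set (x, Fa x) | x in [set: base_itv]].

Definition Wmap F S (alpha : R) Fa j (p : fractal_space Fa) : fractal_space Fa :=
  (Lmap j p.1, alpha *: p.2 + F (Lmap j p.1) - alpha *: S p.1)%K.

End Fractal.

Arguments fractal_graph {R n u} Fa _.
Arguments Wmap {R n u} F S alpha Fa j p.

Section IFS.
Context {R : realType} {X : metricType R} {J : finType}.

Definition complete_space :=
  forall F : set_system X, ProperFilter F -> cauchy F -> exists x : X, F --> x.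

Definition contraction_map (f : X -> X) :=
  exists2 c : R, 0 <= c < 1 & forall x y, mdist (f x) (f y) <= c * mdist x y.

Definition is_ifs (f : J -> X -> X) :=
  complete_space /\ forall j, contraction_map (f j).

Definition is_attractor (f : J -> X -> X) (K : set X) :=
  [/\ is_ifs f, K !=set0, compact K & K = \bigcup_j (f j @` K)].

End IFS.

(* Main.v *)
Require Import Defs.
From mathcomp Require Import all_boot all_order all_algebra.
From mathcomp Require Import all_classical all_reals all_analysis.
From mathcomp Require Import lra ring.

Set Implicit Arguments.
Unset Strict Implicit.
Unset Printing Implicit Defensive.

Import Order.TTheory GRing.Theory Num.Theory.
Import numFieldNormedType.Exports.

Local Open Scope classical_set_scope.
Local Open Scope ring_scope.

(** Everything rests on two ways of reading the twisted metric.

  In the first reading, the self-referential equation says that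
  [Fa (L_j x) = alpha *: Fa x + T_j x] for the same summand
  [T_j x = F (L_j x) - alpha *: S x] that occurs in
  [W_j (x, A) = (L_j x, alpha *: A + T_j x)].  In the distance between
  [W_j (x, A)] and [W_j (y, B)] the two sets to be compared are therefore
  [alpha *: (A + Fa y)] and [alpha *: (B + Fa x)], each augmented by the same
  interval [T_j x + T_j y].  The cancellation law of compact intervals removes
  this interval and the distance is exactly
  [a_j * |x - y| + |alpha| * H_d (A + Fa y, B + Fa x)], whence the contraction
  factor [max a_j |alpha|]; see [mdist_Wmap].  The same identity shows that
  [W_j] maps the point of the graph above [x] to the point above [L_j x], and
  the graph is invariant because the intervals [L_j I] cover [I].

  In the second reading, a compact interval is the pair of its endpoints, and
  moving [Fa] across the difference turns the twisted distance into
  [|x - y|] plus a maximum of two terms: the differences of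
  [inf A - inf (Fa x)] and of [sup A - sup (Fa x)].  These three real
  coordinates embed the space isometrically in a three-dimensional space
  ([fractal_mdist_excess]).  A Cauchy filter has a limit in each coordinate, and
  the limit again comes from a point of the space because [I] is closed and
  [Fa] is continuous ([fractal_complete]).  On the graph the last two
  coordinates vanish, so the graph is isometric to [I], hence compact
  ([fractal_graph_compact]). *)

(** * Minkowski algebra of compact intervals *)

Section MinkowskiAlgebra.
Context {R : realType}.
Implicit Types A B C D : Kc R.

Lemma Kc_addACA A B C D : ((A + B) + (C + D) = (A + C) + (B + D))%K.
Proof. by rewrite -!Kc_addA [(B + (C + D))%K]Kc_addA (Kc_addC B) !Kc_addA. Qed.

Lemma Kc_scaleDr l A B : (l *: (A + B) = l *: A + l *: B)%K.
Proof.
apply: Kc_eq; apply/seteqP; split=> [_ [_ [a Aa [b Bb <-]] <-]|].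
  by exists (l * a); [exists a|exists (l * b); [exists b|rewrite mulrDr]].
move=> _ [_ [a Aa <-] [_ [b Bb <-] <-]].
by exists (a + b); [exists a => //; exists b|rewrite mulrDr].
Qed.

Lemma Kc_scaleBr l A B : (l *: (A - B) = l *: A - l *: B)%K.
Proof.
apply: Kc_eq; apply/seteqP; split=> [_ [_ [a Aa [b Bb <-]] <-]|].
  by exists (l * a); [exists a|exists (l * b); [exists b|rewrite mulrBr]].
move=> _ [_ [a Aa <-] [_ [b Bb <-] <-]].
by exists (a - b); [exists a => //; exists b|rewrite mulrBr].
Qed.

Lemma Kc_subE A B : (A - B = A + -1 *: B)%K.
Proof. by apply: Kc_eq; exact: set_subE. Qed.

Lemma Kc_addBA A B C : (A + (B - C) = A + B - C)%K.
Proof. by rewrite !Kc_subE Kc_addA. Qed.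

(** The exchange that brings the self-referential equation
    [Fa = F + alpha *: (Fa - S)] into the shape of the maps [Wmap]. *)
Lemma Kc_addBCA A B C : (A + (B - C) = B + (A - C))%K.
Proof. by rewrite !Kc_addBA (Kc_addC A). Qed.

(** The endpoints are exchanged when [l] is negative; the maximum here and the
    minimum in the next lemma treat both signs at once. *)
Lemma sup_Kc_scale l A :
  sup (Kc_scale l A) = Num.max (l * inf A) (l * sup A).
Proof.
have mem x : Kc_set A x -> Kc_set (l *: A)%K (l * x) by exists x.
apply/le_anti/andP; split; last first.
  rewrite ge_max; apply/andP; split; apply: Kc_le_sup; apply: mem.
    exact: Kc_inf_mem.
  exact: Kc_sup_mem.
apply: ge_sup; first exact: Kc_neq0.
move=> _ [a /Kc_memE/andP[ia as_] <-]; rewrite le_max.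
have [l0|/ltW l0] := leP 0 l; first by rewrite (ler_wpM2l l0 as_) orbT.
by rewrite (ler_wnM2l l0 ia).
Qed.

Lemma inf_Kc_scale l A :
  inf (Kc_scale l A) = Num.min (l * inf A) (l * sup A).
Proof.
have mem x : Kc_set A x -> Kc_set (l *: A)%K (l * x) by exists x.
apply/le_anti/andP; split.
  rewrite le_min; apply/andP; split; apply: Kc_ge_inf; apply: mem.
    exact: Kc_inf_mem.
  exact: Kc_sup_mem.
apply: lb_le_inf; first exact: Kc_neq0.
move=> _ [a /Kc_memE/andP[ia as_] <-]; rewrite ge_min.
have [l0|/ltW l0] := leP 0 l; first by rewrite (ler_wpM2l l0 ia).
by rewrite (ler_wnM2l l0 as_) orbT.
Qed.

Lemma hausdorff_dist_scale l A B :
  hausdorff_dist (Kc_scale l A) (Kc_scale l B) = `|l| * hausdorff_dist A B.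
Proof.
rewrite !hausdorff_distE !inf_Kc_scale !sup_Kc_scale maxr_pMr// -!normrM.
rewrite !mulrBr.
have [l0|/ltW l0] := leP 0 l.
  have lM C : l * inf C <= l * sup C by rewrite ler_wpM2l// Kc_inf_le_sup.
  by rewrite !(min_idPl (lM _)) !(max_idPr (lM _)).
have lM C : l * sup C <= l * inf C by rewrite ler_wnM2l// Kc_inf_le_sup.
by rewrite !(min_idPr (lM _)) !(max_idPl (lM _)) maxC.
Qed.

Lemma Kc_itv (a b : R) : a <= b -> exists A : Kc R, inf A = a /\ sup A = b.
Proof.
move=> ab.
have cvx : convex_set (`[a, b]%classic : set R^o).
  apply/convex_setP => x y t; rewrite /= !in_itv/=.
  by move=> /andP[ax xb] /andP[ay yb] /andP[t0 t1]; apply/andP; split; nra.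
have ne : `[a, b]%classic !=set0 by exists a; rewrite /= in_itv/= lexx.
pose A := MkKc ne (@segment_compact R a b) cvx.
have AE x : Kc_set A x = (a <= x <= b) by rewrite /= in_itv.
have := Kc_inf_mem A; have := Kc_sup_mem A; rewrite !AE.
move=> /andP[_ sb] /andP[ai _]; exists A; split; apply/le_anti.
  by rewrite ai Kc_ge_inf// AE lexx.
by rewrite sb Kc_le_sup// AE lexx ab.
Qed.

Lemma ler_dist_inf A B : `|inf A - inf B| <= mdist A B.
Proof. by rewrite Kc_mdistE hausdorff_distE le_max lexx. Qed.

Lemma ler_dist_sup A B : `|sup A - sup B| <= mdist A B.
Proof. by rewrite Kc_mdistE hausdorff_distE le_max lexx orbT. Qed.

End MinkowskiAlgebra.

(** * Nonexpansive real functions on a metric space *)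

Section NonexpansiveMaps.
Context {R : realType} {X : metricType R} (f : X -> R).
Hypothesis f_nonexp : forall x y, `|f x - f y| <= mdist x y.

Lemma nonexpansive_continuous : continuous f.
Proof.
move=> x; apply/cvgrPdist_lt => e e0.
near=> y; apply: le_lt_trans (f_nonexp x y) _.
suff : ball x e y by rewrite ballEmdist.
by near: y; exact: nbhsx_ballx.
Unshelve. all: by end_near. Qed.

(** Completeness of the real line, in the form that produces the limit of a
    Cauchy filter coordinate by coordinate. *)
Lemma nonexpansive_cauchy_cvg (F : set_system X) :
  ProperFilter F -> cauchy F -> exists l : R, f @ F --> l.
Proof.
move=> FF /cauchy_ballP cF; apply/cvg_ex; apply: R_complete.
apply/cauchy_exP => e e0.
have /cauchy_ballP/cauchyP/(_ _ e0)[x xe] := cF.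
exists (f x).
suff xf : ball x e `<=` f @^-1` ball (f x) e by exact: filterS xf xe.
by move=> y; rewrite ballEmdist; exact: le_lt_trans.
Qed.

End NonexpansiveMaps.

(** * The partition *)

Section Knots.
Context {R : realType} {n : nat} (u : interval_partition R n).

(** With at least two subintervals, one of the two endpoints of [I] lies outside
    any given subinterval, which is then strictly shorter than [I]. *)
Lemma slope_lt1 (j : 'I_n) : (1 < n)%N -> slope u j < 1.
Proof.
move=> n1; rewrite /slope ltr_pdivrMr ?subr_gt0 ?(knot0_lt_max u j)// mul1r.
have [j0|j0] := posnP j.
  have : kright u j < u ord_max by apply: knot_lt; rewrite /= /bump j0.
  have : u ord0 <= kleft u j by apply: knot_le.
  lra.
have : u ord0 < kleft u j by apply: knot_lt.
have : kright u j <= u ord_max by apply: knot_le; exact: leq_ord.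
lra.
Qed.

Lemma knot_cover (x : base_itv u) :
  (0 < n)%N -> exists j : 'I_n, val x \in `[kleft u j, kright u j].
Proof.
move=> n0; have /andP[x0 x1] := baseP x.
have lastn : (n.-1 < n)%N by rewrite ltn_predL.
have lastP : val x <= kright u (Ordinal lastn).
  apply: le_trans x1 _; apply: knot_le => /=.
  by rewrite /bump add1n prednK.
(* The first subinterval whose right end is not to the left of [x]: by
   minimality its left end is not to the right of [x]. *)
have [j xj jmin] :=
  @arg_minnP _ (Ordinal lastn) (fun j => val x <= kright u j) val lastP.
exists j; rewrite in_itv/= xj andbT.
have [j0|j0] := posnP j.
  by apply: le_trans x0; apply: knot_le; rewrite /= j0.
have ltj : (j.-1 < n)%N by rewrite (leq_ltn_trans (leq_pred _) (ltn_ord j)).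
have [//|xl] := leP (kleft u j) (val x).
have /jmin : val x <= kright u (Ordinal ltj).
  apply: le_trans (ltW xl) _; apply: knot_le => /=.
  by rewrite /bump add1n prednK.
by rewrite /= leqNgt ltn_predL j0.
Qed.

End Knots.

(** * Completeness of the twisted space and compactness of the graph *)

Section FractalSpace.
Context {R : realType} {n : nat} (u : interval_partition R n).
Variable Fa : base_itv u -> Kc R.
Implicit Types p q : fractal_space Fa.

(** The endpoints of a fibre element relative to those of the fractal function;
    together with the abscissa they are isometric coordinates. *)
Definition excess_inf p : R := inf p.2 - inf (Fa p.1).
Definition excess_sup p : R := sup p.2 - sup (Fa p.1).

(** Each endpoint of [A + Fa y] minus that of [B + Fa x] regroups as
    the endpoint of [A] relative to [Fa x] minus that of [B] relative to
    [Fa y], so the twisted distance no longer mixes the two points. *)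
Lemma fractal_mdist_excess p q : mdist p q = `|val p.1 - val q.1| +
  Num.max `|excess_inf p - excess_inf q| `|excess_sup p - excess_sup q|.
Proof.
rewrite fractal_mdistE /fractal_dist hausdorff_distE !inf_Kc_add !sup_Kc_add.
rewrite /excess_inf /excess_sup.
have E (a b c d : R) : a + b - (c + d) = a - d - (c - b) by ring.
by rewrite (E (inf p.2)) (E (sup p.2)).
Qed.

(** The three coordinates are nonexpansive, so they converge along a Cauchy
    filter.  Continuity of [Fa] turns convergence of the relative endpoints into
    convergence of the endpoints themselves, whose limits stay in the right
    order and thus bound a compact interval: the fibre part of the limit. *)
Lemma fractal_complete : continuous Fa -> @complete_space R (fractal_space Fa).
Proof.
move=> cFa F FF cF.
have [x vx] : exists l : R, (fun p : fractal_space Fa => val p.1) @ F --> l.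
  apply: nonexpansive_cauchy_cvg cF => p q.
  by rewrite fractal_mdist_excess lerDl le_max normr_ge0.
have [s es] : exists l : R, excess_inf @ F --> l.
  apply: nonexpansive_cauchy_cvg cF => p q.
  by rewrite fractal_mdist_excess ler_wpDl// le_max lexx.
have [t et] : exists l : R, excess_sup @ F --> l.
  apply: nonexpansive_cauchy_cvg cF => p q.
  by rewrite fractal_mdist_excess ler_wpDl// le_max lexx orbT.
have xP : u ord0 <= x <= u ord_max.
  pose I := `[u ord0, u ord_max]%classic; suff : I x by rewrite /I /= in_itv.
  apply: (closed_cvg (V := R) (fun y => I y) _ _ x vx).
    exact: itv_closed.
  by apply: nearW => p; rewrite /I /= in_itv/= baseP.
pose x' := to_base xP.
have cx : (fun p : fractal_space Fa => p.1) @ F --> x'.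
  apply/cvg_ballP => e e0; exact: (cvgr_dist_lt _ _ vx).
have cF1 := cvg_comp _ _ cx (cFa x').
have ci : (fun p : fractal_space Fa => inf p.2) @ F --> s + inf (Fa x').
  have := nonexpansive_continuous (@ler_dist_inf R) (x := Fa x').
  move=> /(cvg_comp _ _ cF1) /(cvgD es); apply: cvg_trans; apply: near_eq_cvg.
  by apply: nearW => p /=; rewrite /excess_inf subrK.
have cs : (fun p : fractal_space Fa => sup p.2) @ F --> t + sup (Fa x').
  have := nonexpansive_continuous (@ler_dist_sup R) (x := Fa x').
  move=> /(cvg_comp _ _ cF1) /(cvgD et); apply: cvg_trans; apply: near_eq_cvg.
  by apply: nearW => p /=; rewrite /excess_sup subrK.
have st : s + inf (Fa x') <= t + sup (Fa x').
  by apply: ler_cvg_to ci cs _; apply: nearW => p /=; exact: Kc_inf_le_sup.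
have [A [iA sA]] := Kc_itv st.
exists ((x', A) : fractal_space Fa).
apply/cvg_ballP => e e0; near=> p.
rewrite ballEmdist /= fractal_mdist_excess {1}/excess_inf {1}/excess_sup /=.
rewrite iA sA !addrK [e]splitr ltrD// ?gt_max.
  by near: p; apply: (cvgr_dist_lt _ _ vx); rewrite divr_gt0.
apply/andP; split; near: p.
  by apply: (cvgr_dist_lt _ _ es); rewrite divr_gt0.
by apply: (cvgr_dist_lt _ _ et); rewrite divr_gt0.
Unshelve. all: by end_near. Qed.

Lemma knot_ord0_le_max : u ord0 <= u ord_max.
Proof. by apply: knot_le. Qed.

Fact clamp_subproof (y : R) :
  u ord0 <= Num.max (u ord0) (Num.min y (u ord_max)) <= u ord_max.
Proof.
by rewrite le_max lexx /= ge_max knot_ord0_le_max ge_min lexx orbT.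
Qed.

(** The graph parametrized by all of [R], constant on each side of [I]: this
    makes it the image of a segment under an everywhere continuous map. *)
Definition graph_param (y : R) : fractal_space Fa :=
  let x := to_base (clamp_subproof y) in (x, Fa x).

(** The relative endpoints vanish on the graph, where the metric thus reduces to
    that of [I]. *)
Lemma mdist_graph (x y : base_itv u) :
  mdist ((x, Fa x) : fractal_space Fa) (y, Fa y) = `|val x - val y|.
Proof.
rewrite fractal_mdist_excess /excess_inf /excess_sup /=.
by rewrite !subrr normr0 maxxx addr0.
Qed.

Lemma graph_param_continuous : continuous graph_param.
Proof.
move=> y; apply/cvg_ballP => e e0; near=> z.
rewrite ballEmdist /= mdist_graph /=.
apply: (@le_lt_trans _ _ `|y - z|); last first.
  by near: z; exact: (cvgr_dist_lt id y cvg_id).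
(* It remains to see that the retraction of [R] onto [I] is nonexpansive. *)
have ab := knot_ord0_le_max.
rewrite !(maxEle, minEle).
have [yz|zy] := leP y z.
  by rewrite [leRHS]ler0_norm ?subr_le0// ler_norml; repeat case: ifP; lra.
by rewrite [leRHS]gtr0_norm ?subr_gt0// ler_norml; repeat case: ifP; lra.
Unshelve. all: by end_near. Qed.

Lemma graph_paramE : fractal_graph Fa = graph_param @` `[u ord0, u ord_max].
Proof.
apply/seteqP; split=> [_ [x _ <-]|_ [y _ <-]]; last by eexists.
exists (val x); first by rewrite /= in_itv/= baseP.
rewrite /graph_param; set x' := to_base _.
suff -> : x' = x by [].
apply: val_inj => /=; have /andP[x0 x1] := baseP x.
by rewrite (min_idPl x1) (max_idPr x0).
Qed.

Lemma fractal_graph_compact : compact (fractal_graph Fa).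
Proof.
rewrite graph_paramE; apply: continuous_compact.
  by apply: continuous_subspaceT; exact: graph_param_continuous.
exact: segment_compact.
Qed.

End FractalSpace.

(** * The iterated function system *)

Section Attractor.
Context {R : realType} {n : nat} (u : interval_partition R n).
Variables (F S Fa : base_itv u -> Kc R) (alpha : R).

Let T j x := (F (Lmap j x) - alpha *: S x)%K.

Lemma WmapE j (p : fractal_space Fa) :
  Wmap F S alpha Fa j p = (Lmap j p.1, alpha *: p.2 + T j p.1)%K.
Proof. by rewrite /T Kc_addBA. Qed.

Hypothesis Fa_fractal : is_fractal_function F S alpha Fa.

(** The self-referential equation read forwards, from [x] to [L_j x]: the fibre
    part of [Wmap] applied to [Fa x]. *)
Lemma fractal_Lmap j x : Fa (Lmap j x) = (alpha *: Fa x + T j x)%K.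
Proof.
have xj : val (Lmap j x) \in `[kleft u j, kright u j].
  have /andP[x0 x1] := baseP x.
  rewrite in_itv/= -affine_left -affine_right !lerD2r.
  by rewrite !(ler_pM2l (slope_gt0 u j)) x0.
by have [_ /(_ _ _ xj)] := Fa_fractal; rewrite LK Kc_scaleBr Kc_addBCA => ->.
Qed.

Lemma Wmap_graph j x :
  Wmap F S alpha Fa j (x, Fa x) = (Lmap j x, Fa (Lmap j x)).
Proof. by rewrite WmapE fractal_Lmap. Qed.

(** After substituting [fractal_Lmap], both sets contain the summand
    [T j p.1 + T j q.1], which cancels; the common factor [alpha] then comes
    out of the Hausdorff distance. *)
Lemma mdist_Wmap j (p q : fractal_space Fa) :
  mdist (Wmap F S alpha Fa j p) (Wmap F S alpha Fa j q) =
  slope u j * `|val p.1 - val q.1| +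
  `|alpha| * hausdorff_dist (Kc_add p.2 (Fa q.1)) (Kc_add q.2 (Fa p.1)).
Proof.
rewrite fractal_mdistE /fractal_dist !WmapE; congr (_ + _).
  cbn [fst].
  have -> : val (Lmap j p.1) - val (Lmap j q.1) =
      slope u j * (val p.1 - val q.1) by rewrite /=; ring.
  by rewrite normrM (gtr0_norm (slope_gt0 u j)).
cbn [fst snd].
rewrite !fractal_Lmap (Kc_addACA _ (T j p.1)) (Kc_addACA _ (T j q.1)).
rewrite (Kc_addC (T j q.1)) hausdorff_dist_addr -!Kc_scaleDr.
exact: hausdorff_dist_scale.
Qed.

Lemma Wmap_contraction j : (1 < n)%N -> `|alpha| < 1 ->
  contraction_map (Wmap F S alpha Fa j).
Proof.
move=> n1 a1; exists (Num.max (slope u j) `|alpha|).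
  by rewrite le_max normr_ge0 orbT gt_max slope_lt1.
move=> p q; rewrite mdist_Wmap fractal_mdistE mulrDr.
have hd0 (C D : Kc R) : 0 <= hausdorff_dist C D by rewrite -Kc_mdistE mdist_ge0.
by rewrite lerD// ler_wpM2r// le_max lexx ?orbT.
Qed.

Lemma fractal_graph_invariant : (0 < n)%N ->
  fractal_graph Fa = \bigcup_j (Wmap F S alpha Fa j @` fractal_graph Fa).
Proof.
move=> n0; apply/seteqP.
split=> [_ [x _ <-]|_ [j _ [_ [x _ <-] <-]]]; last first.
  by rewrite Wmap_graph; exists (Lmap j x).
have [j xj] := knot_cover x n0; exists j => //.
exists (Linv xj, Fa (Linv xj)); first by exists (Linv xj).
by rewrite Wmap_graph LinvK.
Qed.

End Attractor.

Theorem theorem5p7 (R : realType) (n : nat) (u : interval_partition R n)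
    (F S Fa : base_itv u -> Kc R) (alpha : R) :
  (1 < n)%N ->
  continuous F -> continuous S ->
  (S (first_knot u) - F (first_knot u) = S (last_knot u) - F (last_knot u))%K ->
  -1 < alpha < 1 ->
  is_fractal_function F S alpha Fa ->
  is_attractor (Wmap F S alpha Fa) (fractal_graph Fa).
Proof.
move=> n1 _ _ _ a1 FaP; split.
- split=> [|j]; first by apply: fractal_complete; case: FaP.
  by apply: Wmap_contraction => //; rewrite ltr_norml.
- by exists (first_knot u, Fa (first_knot u)); exists (first_knot u).
- exact: fractal_graph_compact.
- by apply: fractal_graph_invariant => //; exact: ltnW.
Qed.
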